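(* Let $R$ be a finite local ring with maximal ideal $M$. If $|R|/|M|$ is odd, then $\mathcal{G}_{R}\cong\mathcal{G}_{R/M}\otimes\mathring{K}_{|M|}$.
   Context: All rings are finite commutative rings with identity $1\neq 0$. A local ring is a commutative ring with a unique maximal ideal. For a finite commutative ring $R$, let $R^\times$ be its group of units, $Q_R=\{u^2: u\in R^\times\}$ and $T_R=Q_R\cup(-Q_R)$. The quadratic unitary Cayley graph $\mathcal{G}_R$ is the graph with vertex set $R$ in which $x,y\in R$ are adjacent iff $x-y\in T_R$. $\mathring{K}_n$ denotes the complete pseudograph on $n$ vertices: the complete graph $K_n$ with a loop attached at every vertex. The tensor product $G\otimes H$ of two graphs or pseudographs has vertex set $V(G)\times V(H)$, with $(u,v)$ adjacent to $(x,y)$ iff $u$ is adjacent to $x$ in $G$ and $v$ is adjacent to $y$ in $H$. *)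

(* Defs.v *)
From HB Require Import structures.
From mathcomp Require Import all_boot all_order all_algebra generic_quotient.

Set Implicit Arguments.
Unset Strict Implicit.
Unset Printing Implicit Defensive.

Import GRing.Theory.
Local Open Scope ring_scope.

Record pseudograph := Pseudograph {
  vertex :> finType;
  adj : rel vertex;
  adj_sym : symmetric adj
}.

Definition pseudograph_isom (G H : pseudograph) : Prop :=
  exists f : G -> H, bijective f /\ {mono f : x y / adj x y}.

Lemma complete_pseudograph_sym n : symmetric (fun _ _ : 'I_n => true).
Proof. by []. Qed.

(* K_n with a loop at every vertex: any two vertices, equal or not, are
   adjacent. *)
Definition complete_pseudograph (n : nat) : pseudograph :=
  Pseudograph (@complete_pseudograph_sym n).

Section TensorProduct.
Variables G H : pseudograph.

Definition tensor_adj : rel (G * H) :=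
  fun p q => adj p.1 q.1 && adj p.2 q.2.

Lemma tensor_adj_sym : symmetric tensor_adj.
Proof. by move=> p q; rewrite /tensor_adj adj_sym (adj_sym p.2). Qed.

Definition tensor_product : pseudograph := Pseudograph tensor_adj_sym.

End TensorProduct.

Section QuadraticUnitaryCayley.
Variable R : finComUnitRingType.

Definition unit_squares : {set R} :=
  [set u ^+ 2 | u : R & u \is a GRing.unit].

Definition signed_unit_squares : {set R} :=
  unit_squares :|: [set - q | q in unit_squares].

Definition quadratic_unitary_adj : rel R :=
  fun x y => x - y \in signed_unit_squares.

Lemma signed_unit_squaresN x :
  x \in signed_unit_squares -> - x \in signed_unit_squares.
Proof.
rewrite !inE => /orP[Qx | /imsetP[q Qq ->]].
  by rewrite (imset_f (fun q => - q) Qx) orbT.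
by rewrite opprK Qq.
Qed.

Lemma quadratic_unitary_adj_sym : symmetric quadratic_unitary_adj.
Proof.
by move=> x y; apply/idP/idP => /signed_unit_squaresN; rewrite opprB.
Qed.

Definition quadratic_unitary_cayley : pseudograph :=
  Pseudograph quadratic_unitary_adj_sym.

Lemma quadratic_unitary_adj_irr : irreflexive quadratic_unitary_adj.
Proof.
move=> x; rewrite /quadratic_unitary_adj subrr; apply/negP.
have Q0 : 0 \notin unit_squares.
  apply/imsetP=> -[u]; rewrite inE => Uu /esym u2; move: (unitrX 2 Uu).
  by rewrite u2 unitr0.
rewrite inE (negPf Q0) /= => /imsetP[q Qq /eqP].
by rewrite eq_sym oppr_eq0 => /eqP q0; rewrite -q0 Qq in Q0.
Qed.

End QuadraticUnitaryCayley.

(* An [idealr R] is by definition proper. *)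
Definition maximal_ideal (R : comNzRingType) (J : idealr R) : Prop :=
  forall K : idealr R, {subset J <= K} -> K =i J.

Definition local_with_maximal_ideal (R : comNzRingType) (M : idealr R) : Prop :=
  maximal_ideal M /\ forall J : idealr R, maximal_ideal J -> J =i M.

Section FiniteQuotient.
Variables (R : finComUnitRingType) (I : idealr R).

HB.instance Definition _ := Countable.on {ideal_quot I}.
HB.instance Definition _ : isFinite {ideal_quot I} :=
  CanIsFinite (@reprK _ {ideal_quot I}).
HB.instance Definition _ := FinRing.isNzRing.Build {ideal_quot I}.

End FiniteQuotient.

(* Main.v *)
(** A unit of [R] is a signed square as soon as its residue is: if
    [x = u ^+ 2 + m] with [m] in [M], then [x / u ^+ 2] lies in [1 + M], and
    squaring permutes the finite set [1 + M], because
    [a ^+ 2 - b ^+ 2 = (a - b) * (a + b)] and [a + b], congruent to 2, is a unit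
    when the residue field has odd order. Hence adjacency in the graph of [R]
    only depends on residues, and splitting [R] into the cosets of [M] gives
    the isomorphism. *)

Require Import Defs.
From HB Require Import structures.
From mathcomp Require Import fingroup cyclic.
From mathcomp Require Import all_boot all_order all_algebra generic_quotient.

Section Helpers.
Import GRing.Theory.
Local Open Scope ring_scope.

(** Lagrange in the additive group gives [#|A|%:R = 0]; if 2 were 0, the oddness of [#|A|] would
    turn this into 1 = 0. *)
Lemma two_neq0_odd_card (A : finNzRingType) : odd #|A| -> 2%:R != 0 :> A.
Proof.
move=> oddA; apply/eqP => A2.
have cardA : #|A|%:R = 0 :> A.
  by have := expg_cardG (in_setT (1 : A)); rewrite FinRing.zmodXgE cardsT.
move/eqP: cardA; rewrite -(odd_double_half #|A|) oddA natrD -mul2n natrM A2.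
by rewrite mul0r addr0 oner_eq0.
Qed.

Section Ideals.
Variable R : finComUnitRingType.
Implicit Types (S : {set R}) (x : R).

(** A boolean predicate on finite sets, so that [maxset] can supply maximal ideals. *)
Definition idealb S :=
  [&& 0 \in S, 1 \notin S &
    [forall a, forall u in S, forall v in S, a * u + v \in S]].

Lemma idealbP S : reflect (idealr_closed (mem S)) (idealb S).
Proof.
apply: (iffP and3P) => [[S0 S1 SD] | [S0 S1 SD]]; split=> //.
  move=> a u v Su Sv; move/forallP/(_ a)/forall_inP/(_ u Su): SD.
  by move/forall_inP/(_ v Sv).
by apply/forallP=> a; apply/forall_inP=> u Su; apply/forall_inP=> v; apply: SD.
Qed.

Definition idealr_of_closed (S : {pred R}) (SI : idealr_closed S) : idealr R :=
  HB.pack_for (idealr R) S (isIdealr.Build R S SI).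

Lemma idealb_idealr (J : idealr R) : idealb [set x in J].
Proof.
apply/idealbP; split; rewrite ?inE ?idealr1 ?idealr0 //.
by move=> a u v; rewrite !inE => Ju Jv; rewrite rpredD ?idealMr.
Qed.

Lemma idealb_sub_maximal S :
  idealb S -> exists2 K : idealr R, maximal_ideal K & {subset S <= K}.
Proof.
move=> SI; have [K /maxsetP[KI Kmax] sSK] := maxset_exists SI.
exists (idealr_of_closed _ (idealbP _ KI)); last exact/subsetP.
move=> L sKL x; rewrite -[RHS]/(x \in K) -(Kmax _ (idealb_idealr L)) ?inE //.
by apply/subsetP=> y Ky; rewrite inE; apply: sKL.
Qed.

(** The principal ideal of a nonunit is proper, so it lies in some maximal ideal, and [M] is the
    only one. *)
Lemma local_nonunit (M : idealr R) x :
  local_with_maximal_ideal M -> x \isn't a GRing.unit -> x \in M.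
Proof.
move=> [_ Muniq] Nux.
have xI : idealb [set x * r | r : R].
  apply/idealbP; split.
  - by apply/imsetP; exists 0; rewrite ?mulr0.
  - apply/imsetP=> -[r _ /esym xr]; case/negP: Nux.
    by apply/unitrPr; exists r.
  - move=> a _ _ /imsetP[r _ ->] /imsetP[s _ ->]; apply/imsetP.
    by exists (a * r + s); rewrite // mulrDr mulrCA.
have [K Kmax sxK] := idealb_sub_maximal _ xI.
by rewrite -(Muniq K Kmax) sxK //; apply/imsetP; exists 1; rewrite ?mulr1.
Qed.

End Ideals.

(** Without the image set, passing to residues only requires that [pi] commute with negation. *)
Lemma signed_unit_squaresE (A : finComUnitRingType) (x : A) :
  (x \in signed_unit_squares A)
    = (x \in unit_squares A) || (- x \in unit_squares A).
Proof.
rewrite inE; congr (_ || _); apply/imsetP/idP => [[q Qq ->] | Qx].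
  by rewrite opprK.
by exists (- x); rewrite ?opprK.
Qed.

Section Residue.
Variables (R : finComUnitRingType) (M : idealr R).
Local Notation pi := (\pi_({ideal_quot M})%qT).

Lemma pi_eq0 x : (pi x == 0) = (x \in M).
Proof. by rewrite -(rmorph0 pi) -Quotient.idealrBE subr0. Qed.

Lemma sub_repr_pi x : x - repr (pi x) \in M.
Proof. by rewrite -pi_eq0 rmorphB /= reprK subrr. Qed.

(** The graph isomorphism: the coset of [x], and the index in [M] of its offset from the chosen
    representative. *)
Definition coset_pos x : {ideal_quot M} * 'I_#|M| :=
  (pi x, enum_rank_in (idealr0 M) (x - repr (pi x))).

Lemma coset_pos_bij : bijective coset_pos.
Proof.
exists (fun p : {ideal_quot M} * 'I_#|M| => repr p.1 + enum_val p.2) =>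
    [x | [q i]] /=.
  by rewrite enum_rankK_in ?sub_repr_pi // addrC subrK.
have pi_q : pi (repr q + enum_val i) = q.
  by rewrite rmorphD /= reprK (eqP (_ : pi _ == 0)) ?addr0 ?pi_eq0 ?enum_valP.
by rewrite /coset_pos pi_q addrAC subrr add0r enum_valK_in.
Qed.

Lemma card_ideal_quot : #|{: {ideal_quot M}}| = (#|R| %/ #|M|)%N.
Proof.
rewrite (bij_eq_card coset_pos_bij) card_prod card_ord mulnK //.
by apply/card_gt0P; exists 0; apply: idealr0.
Qed.

Hypothesis M_local : local_with_maximal_ideal M.

Lemma pi_unit x : (pi x \is a GRing.unit) = (x \is a GRing.unit).
Proof.
apply/idP/idP => [|]; last exact: rmorph_unit.
apply: contraLR => Nux.
have /eqP -> : pi x == 0 by rewrite pi_eq0 local_nonunit.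
by rewrite unitr0.
Qed.

Hypothesis odd_index : odd (#|R| %/ #|M|).

Lemma sqr_one_add_ideal x : pi x = 1 -> exists2 y, pi y = 1 & x = y ^+ 2.
Proof.
pose U := [set y | pi y == 1].
have two_neq0 : 2%:R != 0 :> {ideal_quot M}.
  by apply: two_neq0_odd_card; rewrite card_ideal_quot.
have sqr_inj : {in U &, injective (fun y : R => y ^+ 2)}.
  move=> a b; rewrite !inE => /eqP a1 /eqP b1 /eqP.
  rewrite -subr_eq0 subr_sqr mulrC.
  (* Otherwise [a + b] lies in [M], and its residue 1 + 1 vanishes. *)
  have ab_unit : a + b \is a GRing.unit.
    apply: contraR two_neq0 => /(local_nonunit _ _ _ M_local).
    by rewrite -pi_eq0 rmorphD /= a1 b1.
  by rewrite -(mulr0 (a + b)) (inj_eq (mulrI ab_unit)) subr_eq0 => /eqP.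
(* Squaring maps [U] into itself injectively, hence onto by counting. *)
have sqrU : [set y ^+ 2 | y in U] = U.
  apply/eqP; rewrite eqEcard card_in_imset // leqnn andbT.
  by apply/subsetP=> _ /imsetP[y + ->]; rewrite !inE rmorphXn /= => /eqP ->;
    rewrite expr1n.
move=> /eqP x1; have : x \in U by rewrite inE.
by rewrite -sqrU => /imsetP[y]; rewrite inE => /eqP y1 ->; exists y.
Qed.

Lemma unit_squares_pi x : (pi x \in unit_squares _) = (x \in unit_squares R).
Proof.
apply/imsetP/imsetP => [[q + xq] | [u + ->]]; rewrite inE; last first.
  by exists (pi u); rewrite ?inE ?pi_unit ?rmorphXn.
(* Any lift of the unit [q] is a unit, so [x] can be divided by [u ^+ 2]; the quotient has residue
   1. *)
rewrite -[q]reprK pi_unit; set u := repr q => Uu.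
have [|y y1 xy] := sqr_one_add_ideal (x / u ^+ 2).
  rewrite rmorphM /= xq -[q]reprK -rmorphXn -rmorphM /= divrr ?rmorph1 //.
  exact: unitrX.
exists (u * y); first by rewrite inE unitrM Uu -pi_unit y1 unitr1.
by rewrite exprMn -xy mulrC divrK // unitrX.
Qed.

Lemma signed_unit_squares_pi x :
  (pi x \in signed_unit_squares _) = (x \in signed_unit_squares R).
Proof.
by rewrite !signed_unit_squaresE -rmorphN !unit_squares_pi.
Qed.

End Residue.
End Helpers.

Theorem theorem2p3 (R : finComUnitRingType) (M : idealr R) :
  local_with_maximal_ideal M ->
  odd (#|R| %/ #|M|) ->
  pseudograph_isom (quadratic_unitary_cayley R)
    (tensor_product (quadratic_unitary_cayley {ideal_quot M})
                    (complete_pseudograph #|M|)).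
Proof.
move=> M_local odd_index; exists (coset_pos R M).
split=> [|x y]; first exact: coset_pos_bij.
(* The complete factor imposes no condition, so only the residue of [x - y] remains. *)
rewrite /= /tensor_adj /= andbT /quadratic_unitary_adj -GRing.rmorphB.
exact: signed_unit_squares_pi.
Qed.
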